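(* Let $X=l^q$ for some real $q\ge 1$, and let $A:X\to X$ be the transition operator of an irreducible positive recurrent Markov chain with countably infinite state space (identified with $\mathbb{Z}_+$ by an enumeration). Then $A$ is not supercyclic on $X$.
   Context: For $1\le q<\infty$, $l^q=l^q(\mathbb{Z}_+)$ is the Banach space of complex sequences $(w_n)_{n\ge0}$ with $\|w\|_q=(\sum_{n\ge0}|w_n|^q)^{1/q}<\infty$. The transition operator $A=[A_{i,j}]$ is a stochastic matrix ($A_{i,j}\ge 0$, $\sum_j A_{i,j}=1$ for every $i$) acting on sequences by $(Ax)_i=\sum_j A_{i,j}x_j$; writing $A:X\to X$ means that this formula defines a bounded linear operator from $X$ to $X$. The chain is irreducible if for each pair $i,j$ there is a nonnegative integer $n$ with $(A^n)_{i,j}>0$. It is positive recurrent if it has an invariant probability distribution, i.e. there is a probability vector $u\in l^1$ with $uA=u$ (where $(uA)_j=\sum_i u_iA_{i,j}$). A linear operator $T:X\to X$ is supercyclic if there exists $x\in X$ such that $\{\lambda T^n x : n\in\mathbb{N},\ \lambda\in\mathbb{C}\}$ is dense in $X$. *)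

(* Defs.v *)
From HB Require Import structures.
From mathcomp Require Import all_boot all_order all_algebra.
From mathcomp Require Import all_classical all_reals all_analysis.
From mathcomp Require Import complex.

Set Implicit Arguments.
Unset Strict Implicit.
Unset Printing Implicit Defensive.

Import Order.TTheory GRing.Theory Num.Theory.
Import numFieldNormedType.Exports.
Import ComplexField.Normc.

Local Open Scope classical_set_scope.
Local Open Scope complex_scope.
Local Open Scope ring_scope.

Section lq_norm.
Context {R : realType}.
Implicit Types (q : R) (v w : nat -> R[i]^o).

(* [normc z] is the modulus of [z] as an element of [R]; the library norm
   [`|z|] of [R[i]] takes its values in [R[i]]. *)
Definition lq_norm q w : \bar R :=
  ((\sum_(n <oo) (normc (w n) `^ q)%:E) `^ q^-1)%E.

Definition lq_finite q : {pred (nat -> R[i]^o)} :=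
  [pred w | (lq_norm q w < +oo)%E].

Lemma normc_ge0 (z : R[i]) : 0 <= normc z.
Proof. by case: z => a b; exact: sqrtr_ge0. Qed.

Lemma normcE (z : R[i]) : (normc z)%:C = `|z|.
Proof. by []. Qed.

Lemma ler_normcD (y z : R[i]) : normc (y + z) <= normc y + normc z.
Proof. by rewrite -lecR rmorphD /= !normcE ler_normD. Qed.

Lemma lq_normE q w : 0 < q ->
  lq_norm q w = ('N[counting]_(q%:E)[EFin \o (fun n => normc (w n))])%E.
Proof.
move=> q0; rewrite Lnorm_counting// /lq_norm; congr (_ `^ _)%E.
by apply: eq_eseriesr => n _ /=; rewrite ger0_norm ?normc_ge0.
Qed.

Lemma lq_norm_ge0 q w : (0 <= lq_norm q w)%E.
Proof. exact: poweR_ge0. Qed.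

Lemma lq_normD q v w : 1 <= q ->
  (lq_norm q (v + w)%R <= lq_norm q v + lq_norm q w)%E.
Proof.
move=> q1; have q0 : 0 < q by exact: lt_le_trans q1.
rewrite !lq_normE//.
apply: le_trans; last exact: minkowski_EFin.
rewrite !Lnorm_counting//; apply: gt0_ler_poweR.
- by rewrite invr_ge0 ltW.
- by rewrite in_itv/= leey andbT nneseries_ge0// => n _ _; rewrite lee_fin powR_ge0.
- by rewrite in_itv/= leey andbT nneseries_ge0// => n _ _; rewrite lee_fin powR_ge0.
apply: lee_nneseries => [n _|n _]; first by rewrite lee_fin powR_ge0.
rewrite /= lee_fin; apply: ge0_ler_powR; rewrite ?nnegrE ?(ltW q0)//.
rewrite !ger0_norm ?addr_ge0 ?normc_ge0//.
exact: ler_normcD.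
Qed.

Lemma lq_normZ q (c : R[i]) w : 1 <= q ->
  lq_norm q (c *: w)%R = ((normc c)%:E * lq_norm q w)%E.
Proof.
move=> q1; have q0 : 0 < q by exact: lt_le_trans q1.
rewrite /lq_norm.
under eq_eseriesr => n _.
  rewrite [(c *: w) n]/(c * w n) normcM powRM ?normc_ge0// EFinM; over.
rewrite nneseriesZl; last by move=> n _; rewrite lee_fin powR_ge0.
rewrite poweRM ?lee_fin ?powR_ge0//; last first.
  by apply: nneseries_ge0 => n _ _; rewrite lee_fin powR_ge0.
by rewrite poweR_EFin -powRrM mulfV ?gt_eqF// powRr1 ?normc_ge0.
Qed.

Lemma lq_norm0 q : 1 <= q -> lq_norm q (0 : nat -> R[i]^o) = 0%E.
Proof.
by move=> q1; rewrite -(scale0r (0 : nat -> R[i]^o)) lq_normZ// normc0 mul0e.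
Qed.

Lemma lq_norm_eq0 q w : 1 <= q -> lq_norm q w = 0%E -> w = 0.
Proof.
move=> q1; have q0 : 0 < q by exact: lt_le_trans q1.
have u0 k : (0 <= (normc (w k) `^ q)%:E)%E by rewrite lee_fin powR_ge0.
have s0 : (0 <= \sum_(n <oo) (normc (w n) `^ q)%:E)%E by exact: nneseries_ge0.
move=> /(poweR_eq0_eq0 s0) w0; apply/funext => n.
have : ((normc (w n) `^ q)%:E <= 0)%E.
  rewrite -w0; apply: le_trans (nneseries_lim_ge n.+1 _) => //.
  by rewrite big_nat_recr//= leeDr// sume_ge0.
rewrite lee_fin => wn0; apply: eq0_normc; apply/eqP.
have /eqP : normc (w n) `^ q = 0 by apply/eqP; rewrite eq_le wn0 powR_ge0.
by rewrite powR_eq0 => /andP[].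
Qed.

Lemma lq_finite_submod_closed q : 1 <= q -> submod_closed (lq_finite q).
Proof.
move=> q1; split; first by rewrite inE lq_norm0.
move=> c v w; rewrite !inE => vfin wfin.
apply: le_lt_trans (lq_normD _ _ q1) _.
rewrite lte_add_pinfty// lq_normZ// lte_mul_pinfty// lee_fin; exact: normc_ge0.
Qed.

End lq_norm.

(* The proof [q1] is a parameter so that the norm structure is canonical. *)
Record lq (R : realType) (q : R) (q1 : 1 <= q) : Type := Lq {
  lq_seq :> nat -> R[i]^o ;
  _ : lq_seq \in lq_finite q }.

Section lq_normedModType.
Context {R : realType} (q : R) (q1 : 1 <= q).

HB.instance Definition _ := [isSub for @lq_seq R q q1].
HB.instance Definition _ := [Choice of lq q1 by <:].
HB.instance Definition _ := GRing.isSubmodClosed.Build _ _ (lq_finite q)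
  (lq_finite_submod_closed q1).
HB.instance Definition _ := [SubChoice_isSubLmodule of lq q1 by <:].

Let nm (w : lq q1) : R[i] := (fine (lq_norm q w))%:C.

Let nmE (w : lq q1) : (fine (lq_norm q w))%:E = lq_norm q w.
Proof.
rewrite fineK// ge0_fin_numE ?lq_norm_ge0//.
by case: w => w /=; rewrite inE.
Qed.

Let ler_nmD (v w : lq q1) : nm (v + w) <= nm v + nm w.
Proof. by rewrite /nm -rmorphD lecR -lee_fin EFinD !nmE lq_normD. Qed.

Let nmZ (c : R[i]) (w : lq q1) : nm (c *: w) = `|c| * nm w.
Proof.
rewrite /nm -normcE -rmorphM; congr (_%:C); apply: EFin_inj.
by rewrite EFinM !nmE lq_normZ.
Qed.

Let nm0_eq0 (w : lq q1) : nm w = 0 -> w = 0.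
Proof.
move=> /complexI w0; apply/val_inj/(lq_norm_eq0 q1).
by rewrite -nmE w0.
Qed.

HB.instance Definition _ :=
  Lmodule_isNormed.Build R[i] (lq q1) ler_nmD nmZ nm0_eq0.

End lq_normedModType.

Lemma lq_normrE (R : realType) (q : R) (q1 : 1 <= q) (w : lq q1) :
  `|w| = (fine (lq_norm q w))%:C.
Proof. by []. Qed.

Section markov_chain.
Context {R : realType}.
Implicit Types P : nat -> nat -> R.

Definition stochastic P : Prop :=
  (forall i j, 0 <= P i j) /\ (forall i, series (P i) @ \oo --> (1 : R)).

(* The limit defining the matrix product exists whenever [P] is stochastic. *)
Fixpoint matrix_power P (n : nat) : nat -> nat -> R :=
  if n is m.+1 then
    fun i j => limn (series (fun k => P i k * matrix_power P m k j))
  else fun i j => (i == j)%:R.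

Definition irreducible_chain P : Prop :=
  forall i j, exists n, 0 < matrix_power P n i j.

Definition positive_recurrent P : Prop :=
  exists u : nat -> R,
    [/\ forall i, 0 <= u i,
        series u @ \oo --> (1 : R) &
        forall j, series (fun i => u i * P i j) @ \oo --> u j].

(* Convergence of the series $\sum_j P_{i,j} x_j$ is part of the definition. *)
Definition transition_operator (q : R) (q1 : 1 <= q) P (A : lq q1 -> lq q1) :
    Prop :=
  forall (x : lq q1) (i : nat),
    series (fun j => ((P i j)%:C * x j : R[i]^o)) @ \oo --> (A x i : R[i]^o).

End markov_chain.

Definition bounded_operator (K : numFieldType) (V : normedModType K)
    (T : V -> V) : Prop :=
  exists M : K, forall x, `|T x| <= M * `|x|.

Definition supercyclic (K : numFieldType) (V : normedModType K) (T : V -> V) :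
    Prop :=
  exists x : V, dense [set y | exists (n : nat) (l : K), y = l *: iter n T x].

(* Main.v *)
(** If [u] is the invariant distribution, then [y |-> sum_i u_i y_i] is invariant
    under [A], while the weighted norm [sum_i u_i |y_i|] does not increase under
    [A]; both are continuous on [l^q].  Orbit points [l A^n x] approximating
    [u_1 e_0 - u_0 e_1], on which the functional vanishes but the norm does not,
    have [|l|] bounded below, so the functional vanishes at [x], hence on the
    whole projective orbit.  It would then vanish at [e_0], where its value is
    [u_0 > 0].  The functional is handled through [sum_i u_i Re (c y_i)] for all
    complex [c], so that only real series occur. *)
Require Import Defs.
From mathcomp Require Import all_boot all_order all_algebra.
From mathcomp Require Import all_classical all_reals all_analysis.
From mathcomp Require Import complex.
From mathcomp Require Import lra.

Import Order.TTheory GRing.Theory Num.Theory.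
Import numFieldNormedType.Exports.
Import ComplexField.Normc.

Local Open Scope classical_set_scope.
Local Open Scope ring_scope.

(** * Means of bounded real sequences under a probability vector *)

Definition bounded_seq {R : realType} (y : nat -> R) : Prop :=
  exists C, forall i, `|y i| <= C.

Definition prob_vector {R : realType} (u : nat -> R) : Prop :=
  (forall i, 0 <= u i) /\ (series u @ \oo --> (1 : R)).

(** [limn] makes this total; for a probability vector [u] and bounded [y] it is a true limit, by
    [mean_cvg]. *)
Definition mean {R : realType} (u y : nat -> R) : R :=
  limn (series (fun i => u i * y i)).

Section mean.
Context {R : realType} (u : nat -> R).
Hypothesis u_prob : prob_vector u.
Implicit Types y z : nat -> R.

Lemma mean_cvg y : bounded_seq y -> cvgn (series (fun i => u i * y i)).
Proof.
case: u_prob => u0 u1 [C yC]; apply: normed_cvg.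
apply: (@series_le_cvg _ _ (fun i => C * u i)) => [i|i|i|].
- exact: normr_ge0.
- by rewrite mulr_ge0// (le_trans _ (yC i)).
- by rewrite /=  normrM ger0_norm// mulrC ler_wpM2r.
- by apply: (@is_cvg_seriesZ R u C); apply/cvg_ex; exists 1.
Qed.

Lemma meanD y z : bounded_seq y -> bounded_seq z ->
  mean u (y \+ z) = mean u y + mean u z.
Proof.
move=> yb zb; rewrite /mean -lim_seriesD; [|exact: mean_cvg..].
by congr (limn (series _)); apply/funext => i /=; rewrite mulrDr.
Qed.

Lemma meanZ (a : R) y : bounded_seq y -> mean u (fun i => a * y i) = a * mean u y.
Proof.
move=> yb; rewrite /mean.
transitivity (limn (series (a *: (fun i => u i * y i : R^o)))).
  by congr (limn (series _)); apply/funext => i /=; rewrite mulrCA.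
by rewrite lim_seriesZ//; exact: mean_cvg.
Qed.

Lemma bounded_seqZ (a : R) y : bounded_seq y -> bounded_seq (fun i => a * y i).
Proof.
by case=> C yC; exists (`|a| * C) => i; rewrite normrM ler_wpM2l.
Qed.

Lemma meanB y z : bounded_seq y -> bounded_seq z ->
  mean u (y \- z) = mean u y - mean u z.
Proof.
move=> yb zb; rewrite -mulN1r -meanZ// -meanD//; last exact: bounded_seqZ.
by congr (mean u _); apply/funext => i /=; rewrite mulN1r.
Qed.

Lemma mean_le y z : bounded_seq y -> bounded_seq z ->
  (forall i, y i <= z i) -> mean u y <= mean u z.
Proof.
move=> yb zb yz; apply: ler_lim; [exact: mean_cvg..|].
apply: nearW => n; apply: ler_sum => i _; apply: ler_wpM2l => //.
exact: u_prob.1.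
Qed.

Lemma mean_cst (C : R) : mean u (fun=> C) = C.
Proof.
rewrite -[RHS]mulr1; case: u_prob => _ u1.
transitivity (mean u (fun i => C * (fun=> 1) i)).
  by congr (mean u _); apply/funext => i; rewrite mulr1.
rewrite meanZ; last by exists 1 => i; rewrite normr1.
congr (_ * _); apply/cvg_lim => //.
by under eq_fun do rewrite mulr1.
Qed.

Lemma mean_norm_le (C : R) y : (forall i, `|y i| <= C) -> `|mean u y| <= C.
Proof.
move=> yC; have yb : bounded_seq y by exists C.
have cb (c : R) : bounded_seq (fun=> c) by exists `|c|.
rewrite ler_norml -[in X in _ && X](mean_cst C) -[X in X <= _](mean_cst (- C)).
by apply/andP; split; apply: mean_le => // i; have := yC i; rewrite ler_norml => /andP[].
Qed.

(** Partial sums of nonnegative terms increase to the mean, and the one of length [i.+1] already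
    contains term [i]. *)
Lemma mean_ge_term y i : bounded_seq y -> (forall j, 0 <= y j) ->
  u i * y i <= mean u y.
Proof.
move=> yb y0; have uy0 j : 0 <= u j * y j by rewrite mulr_ge0// u_prob.1.
apply: (@le_trans _ _ (series (fun j => u j * y j) i.+1)).
  by rewrite seriesSr lerDr sumr_ge0.
apply: nondecreasing_cvgn_le; last exact: mean_cvg.
by apply: nondecreasing_series.
Qed.

Lemma mean_delta k : mean u (fun i => (i == k)%:R) = u k.
Proof.
apply/cvg_lim => //; apply: (@cvg_near_cst) => //.
near=> n.
have kn : (k < n)%N by near: n; exists k.+1.
rewrite /series/= big_mkord (bigD1 (Ordinal kn))//= eqxx mulr1 big1 ?addr0// => i.
by rewrite -val_eqE /= => /negbTE ->; rewrite mulr0.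
Unshelve. all: by end_near. Qed.

End mean.

Lemma bounded_cvg0 {R : realType} (y : nat -> R) : y @ \oo --> (0 : R) -> bounded_seq y.
Proof.
move=> y0; have /cvg_seq_bounded[M [_ yM]] : cvgn y by apply/cvg_ex; exists 0.
by exists (M + 1) => i; apply: yM => //; rewrite ltrDl.
Qed.

(** * Invariance of the mean, and positivity of the invariant distribution *)

Section invariant.
Context {R : realType} (P : nat -> nat -> R) (u : nat -> R).
Hypotheses (P_stochastic : stochastic P) (u_prob : prob_vector u).
Hypothesis u_inv : forall j, series (fun i => u i * P i j) @ \oo --> u j.

Lemma stochastic_row i : prob_vector (P i).
Proof. by case: P_stochastic => P0 P1; split; [exact: P0|exact: P1]. Qed.

(** The entry is the mean of the indicator of [j] under row [i]. *)
Lemma stochastic_le1 i j : P i j <= 1.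
Proof.
have [P0 P1] := stochastic_row i; rewrite -(mean_delta (P i) j).
rewrite (le_trans (ler_norm _))//.
apply: (mean_norm_le _ (stochastic_row i)) => k.
by case: eqP => _; rewrite ?normr1 ?normr0.
Qed.

Lemma bounded_col j : bounded_seq (P^~ j).
Proof.
exists 1 => i; rewrite ger0_norm; first exact: stochastic_le1.
by case: P_stochastic.
Qed.

(* Truncating [y] after [k] terms turns the interchange of the two sums into a
   finite one, at the cost of an error at most [sup_(j >= k) |y j|]. *)
Lemma mean_invariant (y : nat -> R) : y @ \oo --> (0 : R) ->
  mean u (fun i => mean (P i) y) = mean u y.
Proof.
move=> y0; apply/eqP; rewrite -subr_eq0 -normr_le0; apply/ler_addgt0Pl => e e0.
rewrite addr0.
have yb := bounded_cvg0 _ y0; have [C yC] := yb.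
have zC i : `|mean (P i) y| <= C by exact: (mean_norm_le _ (stochastic_row i)).
have zb : bounded_seq (fun i => mean (P i) y) by exists C.
have e20 : 0 < e / 2 by rewrite divr_gt0.
have [k _ yk] : \forall n \near \oo, `|0 - y n| < e / 2.
  by move/cvgrPdist_lt: y0; exact.
pose yt := fun j => if (j < k)%N then y j else 0.
have ytC j : `|yt j| <= C.
  by rewrite /yt; case: ifP => // _; rewrite normr0 (le_trans _ (yC j)).
have ytb : bounded_seq yt by exists C.
have yyt j : `|y j - yt j| <= e / 2.
  rewrite /yt; case: ltnP => [_|kj]; first by rewrite subrr normr0 ltW.
  by have := yk _ kj; rewrite sub0r normrN subr0 => /ltW.
have mean_yt v : prob_vector v -> mean v yt = \sum_(j < k) v j * y j.
  move=> vp; apply/cvg_lim => //; apply: (@cvg_near_cst) => //.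
  near=> n.
  have kn : (k <= n)%N by near: n; exists k.
  rewrite /series/= (big_cat_nat (n := k))//= [X in _ + X]big_nat_cond.
  rewrite [X in _ + X]big1 ?addr0.
    by rewrite big_mkord; apply: eq_bigr => j _; rewrite /yt ltn_ord.
  by move=> j /andP[/andP[kj _] _]; rewrite /yt ltnNge kj mulr0.
have ytzb : bounded_seq (fun i => mean (P i) yt).
  by exists C => i; exact: (mean_norm_le _ (stochastic_row i)).
(* Only the columns [j < k] occur, so the interchange is a finite sum of limits, each given by
   [u_inv]. *)
have myt : mean u (fun i => mean (P i) yt) = mean u yt.
  rewrite mean_yt//; apply/cvg_lim => //.
  have -> : series (fun i => u i * mean (P i) yt) =
      (fun n => \sum_(j < k) y j * series (fun i => u i * P i j) n).
    apply/funext => n; rewrite /series/=.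
    under [RHS]eq_bigr do rewrite mulr_sumr.
    rewrite exchange_big/=; apply: eq_bigr => i _.
    rewrite mean_yt; last exact: stochastic_row.
    rewrite mulr_sumr; apply: eq_bigr => j _.
    by rewrite [RHS]mulrCA [y j * _]mulrC.
  under [X in _ --> X]eq_bigr do rewrite mulrC.
  by apply: cvg_big => [|j _]; [exact: add_continuous|exact: cvgMl_tmp].
(* The truncated parts cancel by [myt]; each of the two remaining means of [y \- yt] is at most
   [e / 2]. *)
have -> : mean u (fun i => mean (P i) y) - mean u y =
    mean u (fun i => mean (P i) (y \- yt)) - mean u (y \- yt).
  have -> : (fun i => mean (P i) (y \- yt)) =
      (fun i => mean (P i) y) \- (fun i => mean (P i) yt).
    by apply/funext => i; rewrite meanB//; exact: stochastic_row.
  by rewrite !meanB// myt opprB addrA subrK.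
rewrite [e]splitr (le_trans (ler_normB _ _))// lerD//.
  apply: (mean_norm_le _ u_prob) => i.
  exact: (mean_norm_le _ (stochastic_row i)).
exact: (mean_norm_le _ u_prob).
Unshelve. all: by end_near. Qed.

(** The left side is a single term of the nonnegative series summing to [u j]. *)
Lemma invariant_ge i j : u i * P i j <= u j.
Proof.
have -> : u j = mean u (P^~ j) by apply/esym/cvg_lim.
apply: (mean_ge_term _ u_prob (P^~ j) i (bounded_col j)) => k.
by case: P_stochastic.
Qed.

(* A state outside the support of [u] cannot be reached from the support. *)
Lemma matrix_power_eq0 n i j : 0 < u i -> u j = 0 -> matrix_power P n i j = 0.
Proof.
move=> + uj0; elim: n i => [|n IH] i ui0 /=.
  by case: eqP => // ij; rewrite ij uj0 ltxx in ui0.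
rewrite [X in series X](_ : _ = fun=> 0); last first.
  apply/funext => k; have : 0 <= u k by case: u_prob.
  (* An intermediate state [k] of positive weight falls under the induction hypothesis; one of
     weight zero has [P i k = 0] by [invariant_ge]. *)
  rewrite le_eqVlt => /orP[/eqP uk0|uk0]; last by rewrite IH ?mulr0.
  suff -> : P i k = 0 by rewrite mul0r.
  have Pik0 : 0 <= P i k by case: P_stochastic.
  have := invariant_ge i k; rewrite -uk0 pmulr_rle0// => Pik.
  by apply/eqP; rewrite eq_le Pik.
apply/cvg_lim => //; rewrite /series/=.
under eq_fun do rewrite big1//.
exact: cvg_cst.
Qed.

(** By irreducibility every state reaches [j], so [u j = 0] would make all weights vanish, against
    total mass 1. *)
Lemma invariant_gt0 : irreducible_chain P -> forall j, 0 < u j.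
Proof.
move=> P_irr j; have [u0 u1] := u_prob.
rewrite lt_neqAle u0 andbT; apply/eqP => /esym uj0.
have u_eq0 i : u i = 0.
  apply/eqP; apply: contraT => ui; have [n] := P_irr i j.
  by rewrite matrix_power_eq0 ?ltxx// lt_neqAle eq_sym ui u0.
have : series u @ \oo --> (0 : R).
  by apply: cvg_near_cst; apply: nearW => n; rewrite /series/= big1.
move=> /(cvg_lim (@Rhausdorff R)); rewrite (cvg_lim (@Rhausdorff R) u1) => /eqP.
by rewrite oner_eq0.
Qed.

End invariant.

(** * Coordinates and unit vectors of $l^q$ *)

Section lq_coordinates.
Context {R : realType} (q : R) (q1 : 1 <= q).
Implicit Types w : lq q1.

Let q_gt0 : 0 < q. Proof. exact: lt_le_trans q1. Qed.

Lemma lq_norm_fin w : (fine (lq_norm q w))%:E = lq_norm q w.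
Proof.
rewrite fineK// ge0_fin_numE ?lq_norm_ge0//.
by case: w => w /=; rewrite inE.
Qed.

Lemma normc_le_lq w i : ((normc (w i))%:C)%C <= `|w|.
Proof.
rewrite lq_normrE lecR -lee_fin lq_norm_fin /lq_norm.
have -> : ((normc (w i))%:E = ((normc (w i) `^ q)%:E) `^ q^-1)%E.
  by rewrite poweR_EFin -powRrM mulfV ?gt_eqF// powRr1 ?normc_ge0.
have s0 n : (0 <= (normc (w n) `^ q)%:E)%E by rewrite lee_fin powR_ge0.
apply: gt0_ler_poweR.
- by rewrite invr_ge0 ltW.
- by rewrite in_itv/= leey andbT.
- by rewrite in_itv/= leey andbT nneseries_ge0.
- apply: le_trans (nneseries_lim_ge i.+1 _) => //.
  by rewrite big_nat_recr//= leeDr// sume_ge0.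
Qed.

Lemma lq_cvg0 w : (fun n => normc (w n)) @ \oo --> (0 : R).
Proof.
have wfin : (\sum_(n <oo) (normc (w n) `^ q)%:E < +oo)%E.
  apply: (@lty_poweRy _ _ q^-1); first by rewrite invr_eq0 gt_eqF.
  by case: w => w /=; rewrite inE.
have s0 n : 0 <= normc (w n) `^ q by exact: powR_ge0.
have /cvg_series_cvg_0 /cvgrPdist_lt sq0 := nnseries_is_cvg s0 wfin.
apply/cvgrPdist_lt => e e0.
have := sq0 _ (powR_gt0 q e0); apply: filterS => n.
rewrite !sub0r !normrN !ger0_norm ?normc_ge0// => we.
rewrite ltNge; apply/negP => ew; move: we; rewrite ltNge => /negP; apply.
by apply: ge0_ler_powR => //; rewrite ?nnegrE ?normc_ge0 ?ltW.
Qed.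

Lemma lq_finite_delta k : (fun i => (i == k)%:R : R[i]^o) \in lq_finite q.
Proof.
rewrite inE /= /lq_norm; apply: poweR_lty.
have s0 n : (0 <= (normc ((n == k)%:R : R[i]) `^ q)%:E)%E by rewrite lee_fin powR_ge0.
rewrite (nneseries_split 0 k.+1)//= add0n eseries0.
  by rewrite adde0 sumEFin ltry.
move=> n kn _; rewrite gtn_eqF// mulr0n normc0 powR0// gt_eqF//.
Qed.

Definition lq_delta k : lq q1 := Lq q1 (lq_finite_delta k).

End lq_coordinates.

(** * Real parts and moduli of complex numbers *)

Lemma Re_norm_le {R : realType} (z : R[i]) : `|complex.Re z| <= normc z.
Proof. by rewrite -lecR; exact: normc_ge_Re. Qed.

Lemma Re_sum {R : realType} (F : nat -> R[i]) n :
  complex.Re (\sum_(0 <= j < n) F j) = \sum_(0 <= j < n) complex.Re (F j).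
Proof. by elim/big_rec2: _ => // i x y _ <-; case: (F i) => a b; case: y. Qed.

Lemma normc_sum {R : realType} (F : nat -> R[i]) n :
  normc (\sum_(0 <= j < n) F j) <= \sum_(0 <= j < n) normc (F j).
Proof.
elim/big_rec2: _ => [|j y x _ xy]; first by rewrite normc0.
by rewrite (le_trans (ler_normcD _ _))// lerD2l.
Qed.

Lemma ReZ {R : realType} (a : R) (z : R[i]) :
  complex.Re (a%:C%C * z) = a * complex.Re z.
Proof. by case: z => b c /=; rewrite mul0r subr0. Qed.

Lemma normc_real {R : realType} (a : R) : 0 <= a -> normc (a%:C%C) = a.
Proof. by move=> a0; rewrite /= expr0n addr0 sqrtr_sqr ger0_norm. Qed.

Lemma cvg_normc {R : realType} (s : nat -> R[i]^o) (l : R[i]^o) :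
  s @ \oo --> l -> forall e : R, 0 < e -> \forall n \near \oo, normc (l - s n) < e.
Proof.
move=> /cvgrPdist_lt sl e e0; have e0' : 0 < e%:C%C by rewrite ltcR.
by have := sl _ e0'; apply: filterS => n; rewrite -Defs.normcE ltcR.
Qed.

(** * The transition operator on real parts and moduli *)

Section transition.
Context {R : realType} (q : R) (q1 : 1 <= q) (P : nat -> nat -> R).
Context (A : lq q1 -> lq q1).
Hypotheses (P_stochastic : stochastic P) (A_transition : transition_operator P A).
Implicit Types x : lq q1.

Lemma lq_bounded x : bounded_seq (fun i => normc (x i)).
Proof. exact/bounded_cvg0/lq_cvg0. Qed.

Lemma lq_Re_cvg0 x : (fun i => complex.Re (x i)) @ \oo --> (0 : R).
Proof.
apply/cvgrPdist_lt => e e0; have /cvgrPdist_lt/(_ e e0) := lq_cvg0 _ q1 x.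
apply: filterS => n; rewrite !sub0r !normrN; apply: le_lt_trans.
by rewrite (le_trans (Re_norm_le _))// ler_norm.
Qed.

Lemma lq_Re_bounded x : bounded_seq (fun i => complex.Re (x i)).
Proof. exact/bounded_cvg0/lq_Re_cvg0. Qed.

(** The entries of [P] are real, so taking real parts commutes with the partial sums, and hence with
    their limit. *)
Lemma transition_Re x i :
  complex.Re (A x i) = mean (P i) (fun j => complex.Re (x j)).
Proof.
apply/esym/cvg_lim => //; apply/cvgrPdist_lt => e e0.
apply: filterS (cvg_normc _ _ (A_transition x i) e e0) => n; apply: le_lt_trans.
apply: le_trans (Re_norm_le _).
rewrite le_eqVlt; apply/orP; left; apply/eqP; congr `|_|.
have -> (a b : R[i]) : complex.Re (a - b) = complex.Re a - complex.Re b.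
  by case: a; case: b.
rewrite /series/= Re_sum; congr (_ - _).
by apply: eq_bigr => j _; rewrite ReZ.
Qed.

(** Triangle inequality on a partial sum within [e] of the limit; the resulting real partial sum is
    below its mean. *)
Lemma transition_normc x i : normc (A x i) <= mean (P i) (fun j => normc (x j)).
Proof.
have [P0 _] := P_stochastic.
apply/ler_addgt0Pl => e e0.
have [n _ /(_ n (leqnn n)) xn] := cvg_normc _ _ (A_transition x i) e e0.
rewrite -(subrK (series (fun j => (P i j)%:C%C * x j) n) (A x i)).
rewrite (le_trans (ler_normcD _ _))// lerD ?(ltW xn)//.
rewrite /series/= (le_trans (normc_sum _ _))//.
under eq_bigr do rewrite normcM normc_real//.
apply: (nondecreasing_cvgn_le (u_ := series (fun j => P i j * normc (x j)))).
  by apply: nondecreasing_series => k _ _; rewrite mulr_ge0 ?normc_ge0.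
by apply: mean_cvg; [exact: stochastic_row|exact: lq_bounded].
Qed.

Context (u : nat -> R).
Hypotheses (u_prob : prob_vector u).
Hypothesis u_inv : forall j, series (fun i => u i * P i j) @ \oo --> u j.

Lemma mean_Re_transition x :
  mean u (fun i => complex.Re (A x i)) = mean u (fun i => complex.Re (x i)).
Proof.
under eq_fun do rewrite transition_Re.
by apply: mean_invariant => //; exact: lq_Re_cvg0.
Qed.

(** Average the pointwise bound [transition_normc] against [u], and apply invariance to the sequence
    of moduli. *)
Lemma mean_normc_transition x :
  mean u (fun i => normc (A x i)) <= mean u (fun i => normc (x i)).
Proof.
rewrite -(mean_invariant P u P_stochastic u_prob u_inv _ (lq_cvg0 _ q1 x)).
have [C xC] := lq_bounded x.
apply: mean_le => //; [exact: lq_bounded| |by move=> i; exact: transition_normc].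
by exists C => i; apply: (mean_norm_le _ (stochastic_row _ P_stochastic i)).
Qed.

End transition.

(** * The invariant functional and the weighted norm on $l^q$ *)

Section functionals.
Context {R : realType} (q : R) (q1 : 1 <= q) (u : nat -> R).
Implicit Types y z : lq q1.

Definition mean_Re y : R := mean u (fun i => complex.Re (y i)).
Definition mean_normc y : R := mean u (fun i => normc (y i)).

Hypothesis u_prob : prob_vector u.

Lemma mean_ReB y z : mean_Re (y - z) = mean_Re y - mean_Re z.
Proof.
rewrite /mean_Re -(meanB u u_prob); [|exact: lq_Re_bounded..].
congr mean; apply/funext => i; transitivity (complex.Re (y i - z i)) => //=.
by case: (y i) => ? ?; case: (z i).
Qed.

Lemma mean_Re_le y (M : R) : (forall i, normc (y i) <= M) -> `|mean_Re y| <= M.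
Proof.
by move=> yM; apply: mean_norm_le => // i; exact: le_trans (Re_norm_le _) (yM i).
Qed.

Lemma mean_normcZ (c : R[i]) y : mean_normc (c *: y) = normc c * mean_normc y.
Proof.
rewrite /mean_normc -(meanZ u u_prob); last exact: lq_bounded.
by congr mean; apply/funext => i; rewrite -normcM.
Qed.

Lemma mean_Re_delta (c : R[i]) k : mean_Re (c *: lq_delta q q1 k) = complex.Re c * u k.
Proof.
rewrite -(mean_delta u k) -(meanZ u u_prob); last first.
  by exists 1 => i; case: eqP => _; rewrite ?normr1 ?normr0.
congr mean; apply/funext => i.
transitivity (complex.Re (c * (i == k)%:R)) => //.
by case: eqP => _; rewrite ?mulr1 ?mulr0.
Qed.

End functionals.

(** * Density and the contradiction *)

Lemma dense_lq_approx {R : realType} {q : R} {q1 : 1 <= q} (S : set (lq q1)) :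
  dense S -> forall (t : lq q1) (e : R), 0 < e ->
  exists2 y, S y & forall i, normc ((y - t) i) <= e.
Proof.
move=> Sd t e e0; have e0' : 0 < e%:C%C by rewrite ltcR.
have [||y [ty Sy]] := Sd (ball t e%:C%C).
- by exists t; exact: ballxx.
- exact: ball_open.
exists y => // i; rewrite -lecR (le_trans (normc_le_lq _ _ _ _))//.
by move: ty; rewrite -ball_normE /= distrC => /ltW.
Qed.

Theorem corollary3p3 (R : realType) (q : R) (q1 : 1 <= q)
    (P : nat -> nat -> R) (A : {linear lq q1 -> lq q1})
    (P_stochastic : stochastic P)
    (A_bounded : bounded_operator A)
    (A_transition : transition_operator P A)
    (P_irreducible : irreducible_chain P)
    (P_recurrent : positive_recurrent P) :
  ~ supercyclic A.
Proof.
case: P_recurrent => u [u0 u1 u_inv] [x orbit_dense].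
have u_prob : prob_vector u by split.
have u_gt0 := invariant_gt0 P u P_stochastic u_prob u_inv P_irreducible.
have approx := dense_lq_approx _ orbit_dense.
pose f := mean_Re q q1 u; pose N := mean_normc q q1 u.
have fB y z : f (y - z) = f y - f z by exact: mean_ReB.
(* Linearity moves [c] inside [A], so invariance of the real part serves every complex multiple. *)
have f_iter c n : f (c *: iter n A x) = f (c *: x).
  elim: n => //= n <-; rewrite -linearZ.
  exact: (mean_Re_transition _ _ _ _ P_stochastic A_transition _ u_prob u_inv).
have N_iter n : N (iter n A x) <= N x.
  elim: n => //= n; apply: le_trans.
  exact: (mean_normc_transition _ _ _ _ P_stochastic A_transition _ u_prob u_inv).
pose d := lq_delta q q1.
pose t : lq q1 := (u 1%N)%:C%C *: d 0%N - (u 0%N)%:C%C *: d 1%N.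
have ft (c : R[i]) : f (c *: t) = 0.
  rewrite /t scalerBr !scalerA fB /f !mean_Re_delta//.
  by case: c => a b /=; rewrite !mulr0 !subr0; lra.
have t0 : t 0%N = (u 1%N)%:C%C.
  have -> : t 0%N = (u 1%N)%:C%C * 1 - (u 0%N)%:C%C * 0 by [].
  by rewrite mulr1 mulr0 subr0.
have fx (c : R[i]) : f (c *: x) = 0.
  (* Lower bound for the weighted norm of an approximant of [t]: coordinate 0 has weight [u 0] and
     modulus at least [u 1 / 2]. *)
  pose m := u 0%N * (u 1%N / 2).
  have m0 : 0 < m by rewrite mulr_gt0 ?divr_gt0.
  apply/eqP; rewrite -normr_le0; apply/ler_addgt0Pl => e e0; rewrite addr0.
  have Nx0 : 0 <= N x.
    apply: le_trans (mean_ge_term u u_prob _ 0%N (lq_bounded _ _ x) _).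
      by rewrite mulr_ge0 ?normc_ge0.
    by move=> j; exact: normc_ge0.
  (* Bounds [normc c / normc l], because [m <= normc l * N x] will hold. *)
  pose B := normc c * N x / m.
  have B0 : 0 <= B := divr_ge0 (mulr_ge0 (normc_ge0 c) Nx0) (ltW m0).
  (* The first bound keeps coordinate 0 above [u 1 / 2]; the second gives [B * r <= e], with [B + 1]
     because [B] may be zero. *)
  pose r := Num.min (u 1%N / 2) (e / (B + 1)).
  have r0 : 0 < r by rewrite lt_min !divr_gt0//; lra.
  have [_ [n [l ->]] yt] := approx t r r0.
  have y0 : u 1%N / 2 <= normc ((l *: iter n A x) 0%N).
    have := yt 0%N; have -> : (l *: iter n A x - t) 0%N =
      (l *: iter n A x) 0%N - t 0%N by [].
    have : r <= u 1%N / 2 by rewrite ge_min lexx.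
    have := ler_normcD ((l *: iter n A x) 0%N) (t 0%N - (l *: iter n A x) 0%N).
    rewrite addrC subrK t0 normc_real// -(normcN (_ - _)) opprB.
    lra.
  have mN : m <= normc l * N x.
    rewrite (@le_trans _ _ (normc l * N (iter n A x)))//; last first.
      by rewrite ler_wpM2l ?normc_ge0.
    rewrite -mean_normcZ//.
    apply: le_trans (mean_ge_term u u_prob _ 0%N (lq_bounded _ _ _) _).
      by rewrite ler_wpM2l.
    by move=> j; exact: normc_ge0.
  have l0 : l != 0.
    by apply: contraTneq mN => ->; rewrite normc0 mul0r -ltNge.
  have nl0 : 0 < normc l.
    rewrite lt_neqAle normc_ge0 andbT eq_sym.
    by apply: contraNneq l0 => /eq0_normc ->.
  (* Since [f] kills multiples of [t] and is constant along the orbit, [f (c *: x)] depends only on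
     the approximation error, rescaled by [c / l]. *)
  have -> : f (c *: x) = f ((c / l) *: (l *: iter n A x - t)).
    by rewrite scalerBr fB ft subr0 scalerA divfK// f_iter.
  have fM : `|f ((c / l) *: (l *: iter n A x - t))| <= normc c / normc l * r.
    apply: mean_Re_le => // i.
    have -> : ((c / l) *: (l *: iter n A x - t)) i =
      (c / l) * (l *: iter n A x - t) i by [].
    by rewrite !normcM normcV ler_wpM2l// divr_ge0 ?normc_ge0.
  apply: (le_trans fM).
  have lB : normc c / normc l <= B.
    rewrite /B -mulrA ler_wpM2l ?normc_ge0// ler_pdivlMr//.
    by rewrite mulrC ler_pdivrMr// mulrC.
  apply: (@le_trans _ _ (B * (e / (B + 1)))).
    apply: ler_pM => //; first by rewrite divr_ge0 ?normc_ge0.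
      exact: ltW.
    by rewrite ge_min lexx orbT.
  rewrite mulrA ler_pdivrMr; last by lra.
  by rewrite mulrC ler_wpM2l ?ltW//; lra.
(* Now [f] vanishes on the whole projective orbit, while [f (d 0) = u 0]; approximating [d 0] within
   [u 0 / 2] is contradictory. *)
have [_ [n [l ->]] yd] := approx (d 0%N) (u 0%N / 2) (divr_gt0 (u_gt0 _) (ltr0Sn _ 1)).
have : `|f (l *: iter n A x - d 0%N)| <= u 0%N / 2 by exact: mean_Re_le.
rewrite fB f_iter fx -[d 0%N]scale1r /f mean_Re_delta//=.
have := u_gt0 0%N; rewrite mul1r sub0r normrN ger0_norm//; lra.
Qed.
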